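(* Let $(\mathbb X,\mathbb U,p,c_t)$ be a finite-horizon Markov decision process with horizon $T$, value functions $V_t$ and optimal strategy $g^*_t$ (all as described in the context). For $x,y\in\mathbb X_{\ge 0}$ and $u\in\mathbb U$ define $$S(y|x;u)=1-\int_{A_y}\big[p(z|x;u)+p(-z|x;u)\big]\,dz,\qquad A_y=\{z\in\mathbb X: z<y\}.$$ Consider the following conditions. (C1) $c_T(\cdot)$ is even and quasi-convex, and for every $t\in\{1,\dots,T-1\}$ and $u\in\mathbb U$, $c_t(\cdot,u)$ is even and quasi-convex. (C2) For every $u\in\mathbb U$, the transition density $p(u)$ is even, i.e. $p(y|x;u)=p(-y|{-x};u)$ for all $x,y\in\mathbb X$. (C3) For every $u\in\mathbb U$ and $y\in\mathbb X_{\ge0}$, $S(y|x;u)$ is increasing in $x$ for $x\in\mathbb X_{\ge0}$. (C4) For every $t\in\{1,\dots,T-1\}$, $c_t(x,u)$ is submodular in $(x,u)$ on $\mathbb X_{\ge0}\times\mathbb U$. (C5) For every $y\in\mathbb X_{\ge0}$, $S(y|x;u)$ is submodular in $(x,u)$ on $\mathbb X_{\ge0}\times\mathbb U$. Then: (i) under (C1)--(C3), $V_t(\cdot)$ is even and quasi-convex for all $t\in\{1,\dots,T\}$; (ii) under (C1)--(C5), $g^*_t(\cdot)$ is even and quasi-convex for all $t\in\{1,\dots,T-1\}$.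
   Context: The state space $\mathbb X$ is either $\mathbb R$ or a symmetric subset of the form $[-a,a]$; $\mathbb X_{\ge0}=\{x\in\mathbb X:x\ge0\}$. The action space $\mathbb U$ is either a countable set or a compact subset of the reals, actions being compared in the order of the reals. For each $u\in\mathbb U$ and $x\in\mathbb X$, $p(\cdot|x;u)$ is a probability density on $\mathbb X$ (the density of $X_{t+1}$ given $X_t=x$, $U_t=u$), continuous in its argument $y$; $p(u)$ denotes the transition density for action $u$. The costs $c_t:\mathbb X\times\mathbb U\to\mathbb R$ ($t=1,\dots,T-1$) and $c_T:\mathbb X\to\mathbb R$ are measurable and lower semi-continuous; the objective is to minimize the expected total cost $\mathbb E[\sum_{t=1}^{T-1}c_t(X_t,U_t)+c_T(X_T)]$ over Markov strategies $U_t=g_t(X_t)$. The value functions are defined recursively by $V_T(x)=c_T(x)$ and, for $t=T-1,\dots,1$, $$Q_t(x,u)=c_t(x,u)+\int_{\mathbb X}p(y|x;u)V_{t+1}(y)\,dy,\qquad V_t(x)=\min_{u\in\mathbb U}Q_t(x,u).$$ The optimal strategy, for $t\in\{1,\dots,T-1\}$, is $$g^*_t(x)=\begin{cases}\max\{v: v\in\arg\min_{u\in\mathbb U}Q_t(x,u)\}, & x\ge0,\\ \min\{v: v\in\arg\min_{u\in\mathbb U}Q_t(x,u)\}, & x<0.\end{cases}$$ It is implicit in these definitions that the integrals are well defined and that the minima and the selected minimizers exist. A function $f:\mathbb X\to\mathbb R$ is called even and quasi-convex if $f(-x)=f(x)$ for all $x$ and $f(x)\le f(x')$ whenever $x,x'\in\mathbb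 X_{\ge0}$, $x<x'$. ''Increasing'' means non-decreasing. A function $f$ on $\mathbb X_{\ge0}\times\mathbb U$ is submodular if $f(x,u)+f(y,v)\le f(x,v)+f(y,u)$ for all $x\ge y$ in $\mathbb X_{\ge0}$ and $u\ge v$ in $\mathbb U$.
   Formalization: Evenness in (ii) fails if minimizers tie at x<0 (e.g. zero costs, two actions); proved: g*_t is quasi-convex always, even when the minimizer is unique at every x<0, and the strategy taking the largest minimizer at every state is even and quasi-convex. *)

(* Defs.v *)
From mathcomp Require Export all_boot all_order all_algebra.
From mathcomp Require Export all_classical all_reals all_analysis.
Export Order.TTheory GRing.Theory Num.Theory.
Export numFieldNormedType.Exports.

Set Implicit Arguments.
Unset Strict Implicit.
Unset Printing Implicit Defensive.

Local Open Scope classical_set_scope.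
Local Open Scope ring_scope.

Definition state_space (R : realType) (X : set R) : Prop :=
  X = setT \/ exists2 a : R, 0 <= a & X = [set` `[- a, a]].

Definition action_space (R : realType) (U : set R) : Prop :=
  countable U \/ compact U.

(* [p y x u] is p(y|x;u).  Functions on X, U or X * U are total functions on R
   of which only the values on these sets matter. *)
Definition transition_density (R : realType) (X U : set R)
    (p : R -> R -> R -> R) : Prop :=
  forall x u, X x -> U u ->
    [/\ {within X, continuous (fun y => p y x u)},
        forall y, X y -> 0 <= p y x u
      & (\int[lebesgue_measure]_(y in X) (p y x u)%:E = 1)%E].

(* Lower semi-continuity is with respect to the relative topology of A. *)
Definition lsc_on (T : topologicalType) (R : realType) (A : set T)
    (f : T -> R) : Prop :=
  lower_semicontinuous ((fun x => (f x)%:E) : subspace A -> \bar R).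

Definition regular_costs (R : realType) (X U : set R) (T : nat)
    (c : nat -> R -> R -> R) (cT : R -> R) : Prop :=
  (forall t, (1 <= t < T)%N ->
     measurable_fun (X `*` U) (fun z : R * R => c t z.1 z.2) /\
     lsc_on (X `*` U) (fun z : R * R => c t z.1 z.2)) /\
  (measurable_fun X cT /\ lsc_on X cT).

Definition argmin (T : Type) d (O : porderType d) (U : set T) (f : T -> O) :
    set T :=
  [set v | U v /\ forall u, U u -> (f v <= f u)%O].

Definition is_max (R : realType) (A : set R) (m : R) : Prop :=
  A m /\ ubound A m.

Definition is_min (R : realType) (A : set R) (m : R) : Prop :=
  A m /\ lbound A m.

(* The integral is taken in the extended reals, so that Q may take the value
   +oo at some non-optimal actions. *)
Definition Qfun (R : realType) (X : set R) (p : R -> R -> R -> R)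
    (c : nat -> R -> R -> R) (V : nat -> R -> R) (t : nat) (x u : R) : \bar R :=
  ((c t x u)%:E
   + \int[lebesgue_measure]_(y in X) (p y x u * V t.+1 y)%:E)%E.

Definition integral_well_defined (R : realType) (X : set R) (f : R -> R) :
    Prop :=
  measurable_fun X f /\
  ((\int[lebesgue_measure]_(y in X) (EFin \o f)^\+ y < +oo)%E \/
   (\int[lebesgue_measure]_(y in X) (EFin \o f)^\- y < +oo)%E).

(* V solves the dynamic programming recursion: this includes that the integrals
   are well defined and that the minima are attained and finite.  These
   conditions determine V on X for t = 1, ..., T. *)
Definition value_functions (R : realType) (X U : set R)
    (p : R -> R -> R -> R) (T : nat) (c : nat -> R -> R -> R) (cT : R -> R)
    (V : nat -> R -> R) : Prop :=
  (forall x, X x -> V T x = cT x) /\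
  (forall t x, (1 <= t < T)%N -> X x ->
     (forall u, U u ->
        integral_well_defined X (fun y => p y x u * V t.+1 y)) /\
     (exists2 v, argmin U (Qfun X p c V t x) v
               & (V t x)%:E = Qfun X p c V t x v)).

(* Ties are broken upwards for x >= 0 and downwards for x < 0.  When Q is even
   in x, the identity g t (- x) = g t x at some x != 0 therefore holds exactly
   when the minimizer at x is unique. *)
Definition optimal_strategy (R : realType) (X U : set R)
    (p : R -> R -> R -> R) (T : nat) (c : nat -> R -> R -> R)
    (V g : nat -> R -> R) : Prop :=
  forall t x, (1 <= t < T)%N -> X x ->
    if 0 <= x then is_max (argmin U (Qfun X p c V t x)) (g t x)
    else is_min (argmin U (Qfun X p c V t x)) (g t x).

(* The same rule with ties broken upwards at every state. *)
Definition greatest_optimal_strategy (R : realType) (X U : set R)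
    (p : R -> R -> R -> R) (T : nat) (c : nat -> R -> R -> R)
    (V g : nat -> R -> R) : Prop :=
  forall t x, (1 <= t < T)%N -> X x ->
    is_max (argmin U (Qfun X p c V t x)) (g t x).

Definition even_on (R : realType) (X : set R) (f : R -> R) : Prop :=
  forall x, X x -> f (- x) = f x.

Definition quasi_convex_on (R : realType) (X : set R) (f : R -> R) : Prop :=
  forall x x', X x -> X x' -> 0 <= x -> x < x' -> f x <= f x'.

Definition even_quasi_convex (R : realType) (X : set R) (f : R -> R) : Prop :=
  even_on X f /\ quasi_convex_on X f.

(* The domain is X_{>=0} * U: 0 <= x follows from 0 <= y and y <= x. *)
Definition submodular (R : realType) (X U : set R) (f : R -> R -> R) : Prop :=
  forall x y u v, X x -> X y -> U u -> U v -> 0 <= y -> y <= x -> v <= u ->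
    f x u + f y v <= f x v + f y u.

(* The integration domain {z in X | z < y} also contains negative z, so this is
   P(|X_{t+1}| >= y | x; u) - 1. *)
Definition Sfun (R : realType) (X : set R) (p : R -> R -> R -> R)
    (y x u : R) : R :=
  1 - \int[lebesgue_measure]_(z in X `&` [set z | z < y])
        (p z x u + p (- z) x u).

Definition C1 (R : realType) (X U : set R) (T : nat) (c : nat -> R -> R -> R)
    (cT : R -> R) : Prop :=
  even_quasi_convex X cT /\
  (forall t u, (1 <= t < T)%N -> U u ->
     even_quasi_convex X (fun x => c t x u)).

Definition C2 (R : realType) (X U : set R) (p : R -> R -> R -> R) : Prop :=
  forall u x y, U u -> X x -> X y -> p y x u = p (- y) (- x) u.

Definition C3 (R : realType) (X U : set R) (p : R -> R -> R -> R) : Prop :=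
  forall u y x x', U u -> X y -> 0 <= y -> X x -> X x' -> 0 <= x -> x <= x' ->
    Sfun X p y x u <= Sfun X p y x' u.

Definition C4 (R : realType) (X U : set R) (T : nat)
    (c : nat -> R -> R -> R) : Prop :=
  forall t, (1 <= t < T)%N -> submodular X U (c t).

Definition C5 (R : realType) (X U : set R) (p : R -> R -> R -> R) : Prop :=
  forall y, X y -> 0 <= y -> submodular X U (Sfun X p y).

(* Main.v *)
Require Import Defs.
From mathcomp Require Import measurable_realfun zify lra.

(* Up to the constant V_{t+1}(0), the continuation cost is the integral of a
   non-negative even quasi-convex function f against p(.|x;u).  By the layer
   cake formula it is the integral over s >= 0 of the mass of [f > s], and up to
   a null set this superlevel set is [|y| > r] for some r in X_{>=0}, of mass
   1 + S(r|x;u).  Monotonicity and submodularity of S thus pass to Q_t.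
   Backward induction gives (i); Topkis' exchange argument for the largest
   minimizer of a submodular function gives (ii).  Everything is done in the
   extended reals because Q_t may be +oo at non-optimal actions. *)

Set Implicit Arguments.
Unset Strict Implicit.
Unset Printing Implicit Defensive.

Local Open Scope classical_set_scope.
Local Open Scope ring_scope.

(** * Integration against densities and reflection of Lebesgue measure *)

(** The constant factors out because [q] has mass 1. Linearity settles the case where [q * W] is
    integrable; otherwise both sides are [+oo], since the negative part of [q * (m + W)] has
    integral at most [|m|]. *)
Lemma integral_density_translate (d : measure_display) (T : measurableType d)
    (R : realType) (mu : {measure set T -> \bar R}) (D : set T) (q W : T -> R)
    (m : R) :
  measurable D -> measurable_fun D q -> measurable_fun D W ->
  (forall y, D y -> 0 <= q y) -> (forall y, D y -> 0 <= W y) ->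
  (\int[mu]_(y in D) (q y)%:E = 1)%E ->
  (\int[mu]_(y in D) (q y * (m + W y))%:E =
   m%:E + \int[mu]_(y in D) (q y * W y)%:E)%E.
Proof.
move=> mD mq mW q0 W0 q1.
have mqE : measurable_fun D (EFin \o q) by exact/measurable_EFinP.
have mqm : measurable_fun D (EFin \o (fun y => m * q y)).
  by apply/measurable_EFinP; exact: measurable_funM.
have mqW : measurable_fun D (EFin \o (fun y => q y * W y)).
  by apply/measurable_EFinP; exact: measurable_funM.
have mqmW : measurable_fun D (EFin \o (fun y => q y * (m + W y))).
  apply/measurable_EFinP; apply: measurable_funM => //.
  exact: measurable_funD.
have qW0 y : D y -> (0%R <= (q y * W y)%:E)%E.
  by move=> Dy; rewrite lee_fin mulr_ge0 ?q0 ?W0.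
have iq : mu.-integrable D (EFin \o q).
  apply/integrableP; split => //.
  suff -> : (\int[mu]_(y in D) `|(EFin \o q) y| = 1)%E by rewrite ltry.
  by rewrite -q1; apply: eq_integral => y /[!inE] Dy /=; rewrite ger0_norm ?q0.
have iqm : mu.-integrable D (EFin \o (fun y => m * q y)).
  exact: (integrableZl mD m iq).
have qm : (\int[mu]_(y in D) (m * q y)%:E = m%:E)%E.
  under eq_integral do rewrite EFinM.
  by rewrite integralZl// q1 mule1.
have [iqW|niqW] := pselect (mu.-integrable D (EFin \o (fun y => q y * W y))).
  under eq_integral do rewrite mulrDr mulrC EFinD.
  by rewrite integralD//= qm.
have qWy : (\int[mu]_(y in D) (q y * W y)%:E = +oo)%E.
  apply/eqP; rewrite -leye_eq leNgt; apply/negP => lty.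
  apply: niqW; apply/integrableP; split => //.
  apply: le_lt_trans lty; rewrite le_eqVlt; apply/orP; left; apply/eqP.
  apply: eq_integral => y /[!inE] Dy /=.
  by rewrite ger0_norm// mulr_ge0 ?q0 ?W0.
rewrite qWy addey//.
pose S y := (q y * (m + W y))%:E.
have mS : measurable_fun D S by exact: mqmW.
have mqa : measurable_fun D (fun y => `|m|%:E * (q y)%:E)%E.
  exact: measurable_funeM.
have qa0 y : D y -> (0%R <= `|m|%:E * (q y)%:E)%E.
  by move=> Dy; rewrite mule_ge0// lee_fin q0.
have qaE : (\int[mu]_(y in D) (`|m|%:E * (q y)%:E) = `|m|%:E)%E.
  by rewrite ge0_integralZl//= q1 mule1.
have SN : (\int[mu]_(y in D) S^\- y <= `|m|%:E)%E.
  rewrite -qaE; apply: ge0_le_integral => //.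
  - exact: measurable_funeneg.
  - move=> y Dy; rewrite funenegE ge_max qa0// andbT -EFinN -EFinM lee_fin.
    have := q0 _ Dy; have := W0 _ Dy; have := ler_norm (- m); rewrite normrN.
    by move=> *; nra.
(* Pointwise [q * W <= S^+ + |m| * q], and the last term has finite integral. *)
have SP : (\int[mu]_(y in D) S^\+ y = +oo)%E.
  suff : (+oo <= \int[mu]_(y in D) S^\+ y + `|m|%:E)%E.
    by case: (\int[mu]_(y in D) S^\+ y)%E => [r||] //; rewrite leye_eq.
  rewrite -qWy -qaE -ge0_integralD//=; last exact: measurable_funepos.
  apply: ge0_le_integral => //.
    by apply: emeasurable_funD => //; exact: measurable_funepos.
  move=> y Dy; apply: (@le_trans _ _ (S y + `|m|%:E * (q y)%:E)%E).
    rewrite -EFinM -EFinD lee_fin.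
    have := q0 _ Dy; have := W0 _ Dy; have := ler_norm (- m); rewrite normrN.
    by move=> *; nra.
  by apply: leeD2r; rewrite funeposE le_max lexx.
rewrite [LHS]integralE SP; move: SN.
have : (0%R <= \int[mu]_(y in D) S^\- y)%E by exact: integral_ge0.
by case: (\int[mu]_(y in D) S^\- y)%E.
Qed.

Local Notation mu := (@lebesgue_measure _).

(** Lebesgue measure is its own pushforward under negation. *)
Lemma ge0_integral_reflect (R : realType) (D : set R) (f : R -> \bar R) :
  measurable D -> measurable_fun D f -> (forall x, D x -> (0 <= f x)%E) ->
  (\int[mu]_(x in D) f x = \int[mu]_(x in -%R @^-1` D) f (- x)%R)%E.
Proof.
move=> mD mf f0.
pose opp : measurableTypeR R -> measurableTypeR R := -%R.
have mopp : measurable_fun setT opp by exact: oppr_measurable.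
transitivity (\int[pushforward mu opp]_(x in D) f x)%E.
  by apply: eq_measure_integral => A mA _; exact/esym/lebesgue_measureN.
by rewrite ge0_integral_pushforward// => x /[!inE]; exact: f0.
Qed.

Lemma lebesgue_measure_set2 (R : realType) (a b : R) :
  lebesgue_measure [set a; b] = 0%E.
Proof.
by apply: countable_lebesgue_measure0; apply: finite_set_countable.
Qed.

Lemma measurable_tail (R : realType) (D : set R) (r : R) :
  measurable D -> measurable (D `&` [set y | r < `|y|]).
Proof.
move=> mD; have : measurable_fun D (fun y => r < `|y|).
  by apply: measurable_fun_ltr => //; exact: measurableT_comp.
by move=> /(_ mD [set true]); exact.
Qed.

(** * State spaces and even quasi-convex functions *)

Lemma state_spaceP (R : realType) (X : set R) :
  state_space X -> is_interval X /\ forall x, X x -> X (- x).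
Proof.
case=> [->|[a a0 ->]]; split => //; first exact: interval_is_interval.
by move=> x /=; rewrite !in_itv/= => /andP[? ?]; apply/andP; split; lra.
Qed.

Lemma state_space_measurable (R : realType) (X : set R) :
  state_space X -> measurable X.
Proof. by move=> /state_spaceP[/is_interval_measurable]. Qed.

Lemma state_space_normr (R : realType) (X : set R) (x : R) :
  state_space X -> X x -> X `|x|.
Proof.
by move=> /state_spaceP[_ XN] Xx; case: (ger0P x) => _ //; exact: XN.
Qed.

Lemma state_space_ge0 (R : realType) (X : set R) (x y : R) :
  state_space X -> X y -> 0 <= x -> x <= y -> X x.
Proof.
move=> /state_spaceP[Xitv XN] Xy x0 xy; apply: (Xitv (- y) y) => //.
  exact: XN.
by apply/andP; split; lra.
Qed.

Lemma even_quasi_convex_normr (R : realType) (X : set R) (f : R -> R) :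
  state_space X -> even_quasi_convex X f ->
  forall x y, X x -> X y -> `|x| <= `|y| -> f x <= f y.
Proof.
move=> hX [fE fQ]; have fabs x : X x -> f `|x| = f x.
  by move=> Xx; case: (ger0P x) => // _; exact: fE.
move=> x y Xx Xy; rewrite -(fabs x)// -(fabs y)// le_eqVlt.
by case/predU1P => [->//|]; apply: fQ => //; exact: state_space_normr.
Qed.

(** On each side of 0 the function is monotone, so [[r <= f]] is a union of two intervals. *)
Lemma even_quasi_convex_measurable (R : realType) (X : set R) (f : R -> R) :
  state_space X -> even_quasi_convex X f -> measurable_fun X f.
Proof.
move=> hX /(even_quasi_convex_normr hX) fle.
have [Xitv XN] := state_spaceP hX.
apply: (measurability (@RGenCInfty.G R)) => [|/= _ [_] [r] -> <-].
  exact: RGenCInfty.measurableE.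
rewrite [X in measurable X](_ : _ =
    [set x | [/\ X x, 0 <= x & r <= f x]] `|`
    [set x | [/\ X x, x <= 0 & r <= f x]]); last first.
  apply/seteqP; split => x /=; rewrite in_itv/= andbT.
    move=> [Xx rf]; have [x0|x0] := leP 0 x; [by left|right].
    by split=> //; exact: ltW.
  by case=> -[].
apply: measurableU; apply: is_interval_measurable => x y /= [Xx x0 rx]
    [Xy y0 ry] z /andP[xz zy]; have Xz : X z by apply: (Xitv x y) => //; lra.
- split=> //; first lra.
  by apply: (le_trans rx); apply: fle; rewrite // !ger0_norm//; lra.
- split=> //; first lra.
  by apply: (le_trans ry); apply: fle; rewrite // !ler0_norm//; lra.
Qed.

(** * Layer cake comparison of integrals *)

(** [W y] is the length of [[0, W y[], so by Tonelli the integral of [q * W] is the integral over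
    [s >= 0] of the [q]-mass of [[W > s]]. These masses are compared level by level. *)
Lemma le_integral_superlevel (R : realType) (q1 q2 W : R -> R) :
  measurable_fun setT q1 -> measurable_fun setT q2 -> measurable_fun setT W ->
  (forall y, 0 <= q1 y) -> (forall y, 0 <= q2 y) -> (forall y, 0 <= W y) ->
  (forall s : R, 0%R <= s%:E ->
    \int[mu]_(y in [set y | (s < W y)%R]) (q1 y)%:E <=
    \int[mu]_(y in [set y | (s < W y)%R]) (q2 y)%:E)%E ->
  (\int[mu]_y (q1 y * W y)%:E <= \int[mu]_y (q2 y * W y)%:E)%E.
Proof.
move=> mq1 mq2 mW q10 q20 W0 q12.
pose GR := measurableTypeR R.
(* [f q] spreads [q] over the region [0 <= s < W y] under the graph of [W]: integrating out [s]
   gives [q * W], integrating out [y] gives the superlevel masses. *)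
pose f (q : R -> R) (z : GR * GR) := (q z.1 * \1_(`[0, W z.1[) z.2)%:E.
have f0 (q : R -> R) : (forall y, 0 <= q y) -> forall z, (0 <= f q z)%E.
  by move=> q0 z; rewrite lee_fin mulr_ge0.
have mf (q : R -> R) : measurable_fun setT q -> measurable_fun setT (f q).
  move=> mq; apply/measurable_EFinP; apply: measurable_funM.
    exact: measurableT_comp.
  have -> : (fun z : GR * GR => \1_(`[0, W z.1[) z.2 : R) =
      \1_([set z : GR * GR | (0 <= z.2) && (z.2 < W z.1)]).
    by apply/funext => z; rewrite !indicE; congr (_%:R); congr nat_of_bool;
      apply/idP/idP => /[!inE] /=; rewrite in_itv.
  apply: measurable_indic.
  have : measurable_fun setT (fun z : GR * GR => (0 <= z.2) && (z.2 < W z.1)).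
    apply: measurable_and; first exact: measurable_fun_ler.
    by apply: measurable_fun_ltr => //; exact: measurableT_comp.
  by move=> /(_ measurableT [set true]); rewrite setTI; exact.
have fE (q : R -> R) : (forall y, 0 <= q y) -> measurable_fun setT q ->
    (\int[mu]_y (q y * W y)%:E =
     \int[mu]_s \int[mu]_y f q (y, s))%E.
  move=> q0 mq; rewrite -(fubini_tonelli (m1 := mu) (m2 := mu) (f q))//=.
  - apply: eq_integral => y _.
    rewrite /f/=; under eq_integral do rewrite EFinM.
    rewrite ge0_integralZl//; last 2 first.
    + by apply/measurable_EFinP; exact: measurable_indic.
    + by rewrite lee_fin.
    rewrite integral_indic// setIT /= lebesgue_measure_itv/= lte_fin EFinM.
    have := W0 y; rewrite le_eqVlt => /predU1P[<-|->].
      by rewrite ltxx.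
    by rewrite sube0.
  - exact: mf.
  - exact: f0.
rewrite !fE//; apply: ge0_le_integral => //.
- by move=> s _; apply: integral_ge0 => y _; exact: f0.
- apply: (measurable_fun_fubini_tonelli_G (m1 := mu) (f q1)); first exact: mf.
  exact: f0.
- apply: (measurable_fun_fubini_tonelli_G (m1 := mu) (f q2)); first exact: mf.
  exact: f0.
(* Levels [s < 0] contribute nothing, as the region lies in [s >= 0]. *)
- move=> s _; have [s0|s0] := leP 0 s; last first.
    rewrite !integral0_eq// => y _; rewrite /f/= indicE memNset ?mulr0//=;
      by rewrite in_itv/=; lra.
  have fsE (q : R -> R) : (\int[mu]_y f q (y, s) =
      \int[mu]_(y in [set y | (s < W y)%R]) (q y)%:E)%E.
    rewrite [RHS]integral_mkcond; apply: eq_integral => y _.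
    rewrite /f/= patchE/= indicE; have [sW|sW] := ltP s (W y).
      by rewrite !mem_set ?mulr1//= in_itv/= s0.
    rewrite memNset ?memNset ?mulr0//=; first by rewrite ltNge sW.
    by rewrite in_itv/= s0/= ltNge sW.
  by rewrite !fsE; apply: q12; rewrite lee_fin.
Qed.

(** The witness is the infimum of [|y|] over the superlevel set. Monotonicity in [|y|] fills in
    everything beyond [r], but points with [|y| = r] may or may not belong, hence one strict and one
    weak inequality. *)
Lemma superlevel_even_quasi_convex (R : realType) (X : set R) (f : R -> R)
    (s : R) : state_space X -> even_quasi_convex X f ->
  X `&` [set y | s < f y] = set0 \/
  exists r, [/\ X r, 0 <= r,
    X `&` [set y | r < `|y|] `<=` X `&` [set y | s < f y] &
    X `&` [set y | s < f y] `<=` [set y | r <= `|y|]].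
Proof.
move=> hX hf; have fle := even_quasi_convex_normr hX hf.
have [->|/set0P[y0 [Xy0 sy0]]] := eqVneq (X `&` [set y | s < f y]) set0.
  by left.
right; pose E := [set z | [/\ 0 <= z, X z & s < f z]].
have Eabs y : X y -> s < f y -> E `|y|.
  move=> Xy sy; split=> //; first exact: state_space_normr.
  apply: (lt_le_trans sy); apply: fle => //; first exact: state_space_normr.
  by rewrite normr_id.
have lbE : has_lbound E by exists 0 => z [].
have hE : has_inf E by split=> //; exists `|y0|; exact: Eabs.
have infE0 : 0 <= inf E.
  by apply: lb_le_inf; [exact: hE.1|move=> z []].
exists (inf E); split=> //.
- apply: (state_space_ge0 hX (state_space_normr hX Xy0)) => //.
  by apply: ge_inf => //; exact: Eabs.
(* As [inf E < |y|], some point of [E] lies below [|y|], and [f y] is at least the value there. *)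
- move=> y [Xy /= ry]; split=> //=.
  have ry0 : 0 < `|y| - inf E by rewrite subr_gt0.
  have [z [z0 Xz sz] zy] := inf_adherent ry0 hE.
  apply: (lt_le_trans sz); apply: fle => //.
  by rewrite ger0_norm//; lra.
- by move=> y [Xy sy] /=; apply: ge_inf => //; exact: Eabs.
Qed.

(** Extension by 0 outside [X] reduces to the whole line. Each superlevel set of [W] is empty or, up
    to a null set, a tail, so only tail masses at [r] in [X_{>=0}] have to be compared; these are
    what the conditions on [S] control. *)
Lemma le_integral_tail (R : realType) (X : set R) (q1 q2 W : R -> R) :
  state_space X -> measurable_fun X q1 -> measurable_fun X q2 ->
  (forall y, X y -> 0 <= q1 y) -> (forall y, X y -> 0 <= q2 y) ->
  even_quasi_convex X W -> (forall y, X y -> 0 <= W y) ->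
  (forall r : R, X r -> 0%R <= r%:E ->
    \int[mu]_(y in X `&` [set y | (r < `|y|)%R]) (q1 y)%:E <=
    \int[mu]_(y in X `&` [set y | (r < `|y|)%R]) (q2 y)%:E)%E ->
  (\int[mu]_(y in X) (q1 y * W y)%:E <= \int[mu]_(y in X) (q2 y * W y)%:E)%E.
Proof.
move=> hX mq1 mq2 q10 q20 hW W0 q12.
have mX := state_space_measurable hX.
have mW := even_quasi_convex_measurable hX hW.
have pT (f : R -> R) : measurable_fun X f -> measurable_fun setT (f \_ X).
  by move=> mf; apply/(measurable_restrictT _ _).1.
have p0 (f : R -> R) : (forall y, X y -> 0 <= f y) -> forall y, 0 <= (f \_ X) y.
  by move=> f0 y; rewrite patchE; case: ifPn => // /set_mem; exact: f0.
have pE (f : R -> R) : (\int[mu]_(y in X) (f y * W y)%:E =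
    \int[mu]_y ((f \_ X) y * (W \_ X) y)%:E)%E.
  rewrite integral_mkcond; apply: eq_integral => y _.
  by rewrite !patchE; case: ifPn => //; rewrite mulr0.
(* Since [s >= 0], no point outside [X], where the extension is 0, exceeds the level. *)
have sE (s : R) (f : R -> R) : 0 <= s ->
    (\int[mu]_(y in [set y | (s < (W \_ X) y)%R]) ((f \_ X) y)%:E =
     \int[mu]_(y in X `&` [set y | (s < W y)%R]) (f y)%:E)%E.
  move=> s0; rewrite [LHS]integral_mkcond [RHS]integral_mkcond.
  apply: eq_integral => y _; rewrite !patchE.
  have [Xy|nXy] := pselect (X y).
    rewrite (mem_set Xy); congr (if _ then _ else _).
    by apply/idP/idP => /[!inE] /=; rewrite patchE mem_set// => -[].
  rewrite [in RHS]memNset; last by case.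
  by rewrite memNset//= patchE memNset// ltNge s0.
rewrite !pE; apply: le_integral_superlevel;
  [exact: pT..|exact: p0|exact: p0|exact: p0|].
move=> s s0; rewrite !sE -?lee_fin//.
have [->|[r [Xr r0 sub1 sub2]]] := superlevel_even_quasi_convex s hX hW.
  by rewrite !integral_set0.
have mE : measurable (X `&` [set y | s < W y]).
  have : measurable_fun X (fun y => s < W y).
    by apply: measurable_fun_ltr => //; exact: measurable_cst.
  by move=> /(_ mX [set true]); exact.
have mA := measurable_tail r mX.
have EE (f : R -> R) : measurable_fun X f -> (forall y, X y -> 0 <= f y) ->
   (\int[mu]_(y in X `&` [set y | (s < W y)%R]) (f y)%:E =
    \int[mu]_(y in X `&` [set y | (r < `|y|)%R]) (f y)%:E)%E.
  (* Off the null set [{r, -r}] the conditions [r < |y|] and [r <= |y|] agree, so the two inclusions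
     determine the superlevel set. *)
  move=> mf f0; pose N : set R := [set r; - r].
  have mfX A : measurable_fun (X `&` A) (EFin \o f).
    by apply/measurable_EFinP; apply: measurable_funS mf.
  have mN : measurable N by exact: measurableU.
  rewrite (@ge0_negligible_integral _ (measurableTypeR R) R
    lebesgue_measure _ N)//; last 3 first.
  - exact: mfX.
  - by move=> y [/f0].
  - exact: lebesgue_measure_set2.
  rewrite [RHS](@ge0_negligible_integral _ (measurableTypeR R) R
    lebesgue_measure _ N)//; last 3 first.
  - exact: mfX.
  - by move=> y [/f0].
  - exact: lebesgue_measure_set2.
  congr integral; apply/seteqP; split => y [yE yN]; split => //;
    last exact: sub1.
  split; first by case: yE.
  rewrite /= lt_neqAle sub2// andbT; apply: contra_not_neq yN => ry.
  by rewrite /N/= ry; case: (ger0P y) => _; [left|right; rewrite opprK].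
by rewrite !EE//; apply: q12 => //; rewrite lee_fin.
Qed.

(** * Tail masses of the transition law *)

(** The integral in [Sfun] also runs over negative [z], so it equals the mass of [y < r] plus that
    of [- y < r]. Together with the tail mass these make 2, which leaves [2 - (1 - S) = 1 + S] for
    the tail. *)
Lemma integral_Sfun (R : realType) (X U : set R) (p : R -> R -> R -> R)
    (r x u : R) : state_space X -> transition_density X U p ->
  X x -> U u -> 0 <= r ->
  (\int[mu]_(y in X `&` [set y | (r < `|y|)%R]) (p y x u)%:E =
   (1 + Sfun X p r x u)%R%:E)%E.
Proof.
move=> hX hp Xx Uu r0; have [cp p0 p1] := hp x u Xx Uu.
have [_ XN] := state_spaceP hX.
have XNE y : X (- y) = X y.
  by apply/propext; split => /XN //; rewrite opprK.
have mX := state_space_measurable hX.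
have mp : measurable_fun X (fun y => p y x u).
  exact: subspace_continuous_measurable_fun.
pose q y := p y x u; rewrite -/q in mp p0 p1.
have mqE : measurable_fun X (EFin \o q) by exact/measurable_EFinP.
pose I (P : set R) : \bar R := (\int[mu]_(y in X `&` P) (q y)%:E)%E.
have mqS P : measurable_fun (X `&` P) (EFin \o q).
  exact: (measurable_funS mX _ mqE).
have mlt : measurable [set y | y < r].
  by rewrite (_ : [set y | y < r] = `]-oo, r[%classic).
have mgt : measurable [set y | - y < r].
  rewrite (_ : [set y | - y < r] = `](- r), +oo[%classic)//.
  by apply/seteqP; split => y /=; rewrite in_itv/= andbT ltrNl.
have mout : measurable [set y : R | r < `|y|].
  by rewrite -[X in measurable X]setTI; exact: measurable_tail.
have I_ge0 P : (0 <= I P)%E.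
  by apply: integral_ge0 => y [Xy _]; rewrite lee_fin; exact: p0.
(* Finiteness permits the passage between extended-real integrals and the real-valued integral in
   [Sfun]. *)
have I_fin P : measurable P -> I P \is a fin_num.
  move=> mP; rewrite ge0_fin_numE//.
  apply: (@le_lt_trans _ _ 1%E); last exact: ltry.
  rewrite -p1; apply: ge0_subset_integral => //; exact: measurableI.
(* For y other than r and - r, exactly two of y < r, - y < r, r < |y| hold. *)
have I_sum : (I [set y | (y < r)%R] + I [set y | (- y < r)%R] +
    I [set y | (r < `|y|)%R] = 2%R%:E)%E.
  have IE P : I P = (\int[mu]_(y in X) ((EFin \o q) \_ P) y)%E.
    exact: integral_mkcondr.
  have mqP P : measurable P -> measurable_fun X ((EFin \o q) \_ P).
    by move=> mP; apply/(measurable_restrict _ mP mX); exact: mqS.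
  have qP0 P y : X y -> (0 <= ((EFin \o q) \_ P) y)%E.
    move=> Xy; rewrite patchE; case: ifPn => // _.
    by rewrite lee_fin; exact: p0.
  rewrite !IE -ge0_integralD//=; try by [move=> *; exact: qP0|exact: mqP].
  rewrite -ge0_integralD//=; last 4 first.
  - by move=> y Xy; apply: adde_ge0; exact: qP0.
  - by apply: emeasurable_funD; exact: mqP.
  - by move=> y Xy; exact: qP0.
  - exact: mqP.
  pose N : set R := [set r; - r].
  have mN : measurable N by exact: measurableU.
  transitivity (\int[mu]_(y in X) (2%R%:E * (q y)%:E))%E; last first.
    by rewrite ge0_integralZl//= p1 mule1.
  rewrite (@ge0_negligible_integral _ (measurableTypeR R) R
    lebesgue_measure _ N)//; last 3 first.
  - by apply: emeasurable_funD; [apply: emeasurable_funD|]; exact: mqP.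
  - by move=> y Xy; rewrite !adde_ge0//; exact: qP0.
  - exact: lebesgue_measure_set2.
  rewrite [RHS](@ge0_negligible_integral _ (measurableTypeR R) R
    lebesgue_measure _ N)//; last 3 first.
  - exact: measurable_funeM.
  - by move=> y Xy; rewrite mule_ge0// lee_fin; exact: p0.
  - exact: lebesgue_measure_set2.
  apply: eq_integral => y /[!inE] -[Xy yN].
  have [yr yNr] : y <> r /\ - y <> r.
    by split=> yE; apply: yN; [left|right; rewrite /= -yE opprK].
  have memE (b : R -> bool) : (y \in [set z | b z]) = b y.
    by apply/idP/idP => /[!inE].
  rewrite !patchE (memE (fun z => z < r)) (memE (fun z => - z < r)).
  (* Outside its set a restriction takes the default value [point], which is 0 in the extended
     reals. *)
  rewrite (memE (fun z => r < `|z|)) (_ : point = 0%E)//= -EFinM mulr_natl.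
  have [y0|y0] := ger0P (y : R); case: (ltgtP (y : R) r) => // ?;
    case: (ltgtP (- (y : R)) r) => // ?; rewrite ?adde0 ?add0e //; exfalso; lra.
have mqN : measurable_fun (X `&` [set y | y < r]) ((EFin \o q) \o -%R).
  by apply: (measurable_comp mX) => // _ [y [Xy _] <-]; exact: XN.
have -> : Sfun X p r x u =
    1 - fine (I [set y | (y < r)%R] + I [set y | (- y < r)%R])%E.
  rewrite /Sfun /Rintegral; congr (1 - fine _).
  under eq_integral do rewrite EFinD.
  rewrite ge0_integralD//=; last 4 first.
  - exact: measurableI.
  - by move=> y [Xy _]; rewrite lee_fin; exact: p0.
  - exact: mqS.
  - by move=> y [/XN Xy _]; rewrite lee_fin; exact: p0.
  (* Reflection turns the term with [p (- z)] into the mass of [[- y < r]]. *)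
  congr (_ + _)%E; rewrite /I ge0_integral_reflect//.
  - congr integral; apply/seteqP; split => y /=; by rewrite XNE opprK.
  - exact: measurableI.
  - by move=> y [Xy _]; rewrite lee_fin; exact: p0.
rewrite -[LHS]/(I [set y | r < `|y|]).
move: I_sum (I_fin _ mlt) (I_fin _ mgt) (I_fin _ mout).
move: (I _) (I _) (I _) => [a| |] [b| |] [d| |] //= [abd] _ _ _.
by congr (_%:E); lra.
Qed.

(** * Evenness, monotonicity and submodularity of [Q_t] *)

Lemma density_measurable (R : realType) (X U : set R) (p : R -> R -> R -> R)
    (x u : R) : state_space X -> transition_density X U p -> X x -> U u ->
  measurable_fun X (fun y => p y x u).
Proof.
move=> hX hp Xx Uu; have [cp _ _] := hp x u Xx Uu.
apply: subspace_continuous_measurable_fun => //.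
exact: state_space_measurable.
Qed.

(** For an even quasi-convex [f] the value [f 0] is the minimum over the state space, so this shift
    gives the non-negative integrand that the layer cake argument requires. *)
Definition excess (R : realType) (f : R -> R) (y : R) : R := f y - f 0.

Lemma excess_even_quasi_convex (R : realType) (X : set R) (f : R -> R) :
  even_quasi_convex X f -> even_quasi_convex X (excess f).
Proof.
move=> [fE fQ]; split => [x Xx|x x' Xx Xx' x0 xx'].
  by rewrite /excess fE.
by rewrite lerD2r; exact: fQ.
Qed.

Lemma excess_ge0 (R : realType) (X : set R) (f : R -> R) (y : R) :
  state_space X -> even_quasi_convex X f -> X y -> 0 <= excess f y.
Proof.
move=> hX hf Xy; rewrite subr_ge0; apply: (even_quasi_convex_normr hX hf) => //.
  exact: (state_space_ge0 hX (state_space_normr hX Xy)).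
by rewrite normr0.
Qed.

Lemma excess_measurable (R : realType) (X : set R) (f : R -> R) :
  state_space X -> even_quasi_convex X f -> measurable_fun X (excess f).
Proof.
move=> hX /excess_even_quasi_convex; exact: even_quasi_convex_measurable.
Qed.

(** As [p(.|x;u)] has mass 1, [V_{t+1}(0)] leaves the integral. What remains is the integral of a
    non-negative function, comparable through tails even when infinite. *)
Lemma QfunE (R : realType) (X U : set R) (p : R -> R -> R -> R)
    (c : nat -> R -> R -> R) (V : nat -> R -> R) (t : nat) (x u : R) :
  state_space X -> transition_density X U p -> even_quasi_convex X (V t.+1) ->
  X x -> U u ->
  Qfun X p c V t x u = ((c t x u + V t.+1 0)%:E +
    \int[mu]_(y in X) (p y x u * excess (V t.+1) y)%:E)%E.
Proof.
move=> hX hp hV Xx Uu; have [cp p0 p1] := hp x u Xx Uu.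
rewrite /Qfun EFinD -addeA; congr (_ + _)%E.
rewrite -integral_density_translate//.
- by apply: eq_integral => y _; rewrite /excess addrC subrK.
- exact: state_space_measurable.
- exact: density_measurable hX hp Xx Uu.
- exact: excess_measurable.
- by move=> y; exact: excess_ge0.
Qed.

(** After substituting [- y] for [y], (C2) turns [p(- y | - x; u)] into [p(y | x; u)], and the
    excess is even. *)
Lemma Qfun_opp (R : realType) (X U : set R) (p : R -> R -> R -> R)
    (c : nat -> R -> R -> R) (V : nat -> R -> R) (t : nat) (x u : R) :
  state_space X -> transition_density X U p -> C2 X U p ->
  even_on X (c t ^~ u) -> even_quasi_convex X (V t.+1) -> X x -> U u ->
  Qfun X p c V t (- x) u = Qfun X p c V t x u.
Proof.
move=> hX hp hC2 hc hV Xx Uu; have [_ XN] := state_spaceP hX.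
have XNx := XN _ Xx.
rewrite !(@QfunE R X U)// hc//; congr (_ + _)%E.
have [_ p0 _] := hp _ _ XNx Uu.
rewrite ge0_integral_reflect; last 3 first.
- exact: state_space_measurable.
- apply/measurable_EFinP; apply: measurable_funM.
    exact: density_measurable hX hp XNx Uu.
  exact: excess_measurable.
- move=> y Xy; rewrite lee_fin mulr_ge0//; first exact: p0.
  exact: excess_ge0 hX hV Xy.
rewrite (_ : -%R @^-1` X = X); last first.
  by apply/seteqP; split => y /= /XN //; rewrite opprK.
apply: eq_integral => y /[!inE] Xy.
by rewrite -hC2// (excess_even_quasi_convex hV).1.
Qed.

(** By (C3) the tail masses [1 + S] grow with the state, which orders the continuation costs. *)
Lemma le_Qfun (R : realType) (X U : set R) (p : R -> R -> R -> R)
    (c : nat -> R -> R -> R) (V : nat -> R -> R) (t : nat) (x x' u : R) :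
  state_space X -> transition_density X U p -> C3 X U p ->
  quasi_convex_on X (c t ^~ u) -> even_quasi_convex X (V t.+1) ->
  X x -> X x' -> U u -> 0 <= x -> x < x' ->
  (Qfun X p c V t x u <= Qfun X p c V t x' u)%E.
Proof.
move=> hX hp hC3 hc hV Xx Xx' Uu x0 xx'.
rewrite !(@QfunE R X U)//; apply: leeD.
  by rewrite lee_fin lerD2r; exact: hc.
have [_ p0 _] := hp _ _ Xx Uu; have [_ p0' _] := hp _ _ Xx' Uu.
apply: le_integral_tail => //.
- exact: density_measurable hX hp Xx Uu.
- exact: density_measurable hX hp Xx' Uu.
- exact: excess_even_quasi_convex.
- by move=> y; exact: excess_ge0.
- move=> r Xr; rewrite lee_fin => r0.
  rewrite !(@integral_Sfun _ _ U)// lee_fin lerD2l; apply: hC3 => //.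
  exact: ltW.
Qed.

(** The four continuation terms are paired into integrals against [p(.|x;u) + p(.|y;v)] and
    [p(.|x;v) + p(.|y;u)], whose tail masses are compared by (C5). Sums rather than differences keep
    the argument valid at [+oo]. *)
Lemma Qfun_submodular (R : realType) (X U : set R) (p : R -> R -> R -> R)
    (c : nat -> R -> R -> R) (V : nat -> R -> R) (t : nat) (x y u v : R) :
  state_space X -> transition_density X U p -> C5 X U p ->
  submodular X U (c t) -> even_quasi_convex X (V t.+1) ->
  X x -> X y -> U u -> U v -> 0 <= y -> y <= x -> v <= u ->
  (Qfun X p c V t x u + Qfun X p c V t y v <=
   Qfun X p c V t x v + Qfun X p c V t y u)%E.
Proof.
move=> hX hp hC5 hc hV Xx Xy Uu Uv y0 yx vu.
have mX := state_space_measurable hX.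
rewrite !(@QfunE R X U)// addeACA [leRHS]addeACA; apply: leeD.
  by rewrite -!EFinD lee_fin; have := hc x y u v Xx Xy Uu Uv y0 yx vu; lra.
have mp z w : X z -> U w -> measurable_fun X (fun a => p a z w).
  exact: density_measurable.
have p0 z w : X z -> U w -> forall a, X a -> 0 <= p a z w.
  by move=> Xz Uw; have [] := hp z w Xz Uw.
have mpV z w : X z -> U w ->
    measurable_fun X (fun a => (p a z w * excess (V t.+1) a)%:E).
  move=> Xz Uw; apply/measurable_EFinP; apply: measurable_funM; first exact: mp.
  exact: excess_measurable.
have pV0 z w : X z -> U w ->
    forall a, X a -> (0 <= (p a z w * excess (V t.+1) a)%:E)%E.
  move=> Xz Uw a Xa; rewrite lee_fin mulr_ge0//; first exact: p0.
  exact: excess_ge0 hX hV Xa.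
have integralD z w z' w' : X z -> U w -> X z' -> U w' ->
    (\int[mu]_(a in X) (p a z w * excess (V t.+1) a)%:E +
     \int[mu]_(a in X) (p a z' w' * excess (V t.+1) a)%:E =
     \int[mu]_(a in X) ((p a z w + p a z' w') * excess (V t.+1) a)%:E)%E.
  move=> Xz Uw Xz' Uw'; rewrite -ge0_integralD//.
  - by apply: eq_integral => a _; rewrite mulrDl.
  - exact: pV0.
  - exact: mpV.
  - exact: pV0.
  - exact: mpV.
rewrite !integralD//; apply: le_integral_tail => //.
- by apply: measurable_funD; exact: mp.
- by apply: measurable_funD; exact: mp.
- by move=> a Xa; apply: addr_ge0; exact: p0.
- by move=> a Xa; apply: addr_ge0; exact: p0.
- exact: excess_even_quasi_convex.
- by move=> a; exact: excess_ge0.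
- move=> r Xr; rewrite lee_fin => r0.
  (* Each density contributes its own 1 from [1 + S], hence the constant 2. *)
  have tailD z w z' w' : X z -> U w -> X z' -> U w' ->
      (\int[mu]_(a in X `&` [set a | (r < `|a|)%R]) (p a z w + p a z' w')%:E =
       (2 + (Sfun X p r z w + Sfun X p r z' w'))%R%:E)%E.
    move=> Xz Uw Xz' Uw'; under eq_integral do rewrite EFinD.
    have mtail := measurable_tail r mX.
    have mpS z1 w1 : X z1 -> U w1 ->
        measurable_fun (X `&` [set a : R | r < `|a|]) (fun a => (p a z1 w1)%:E).
      move=> Xz1 Uw1; apply/measurable_EFinP.
      by apply: measurable_funS (mp _ _ Xz1 Uw1).
    rewrite ge0_integralD//; last 4 first.
    - by move=> a [Xa _]; rewrite lee_fin; exact: p0.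
    - exact: mpS.
    - by move=> a [Xa _]; rewrite lee_fin; exact: p0.
    - exact: mpS.
    by rewrite !(@integral_Sfun _ _ U)// -EFinD; congr EFin; lra.
  rewrite !tailD// lee_fin lerD2l; exact: hC5.
Qed.

(** * Backward induction for the value functions *)

Lemma value_even_quasi_convex (R : realType) (X U : set R)
    (p : R -> R -> R -> R) (T : nat) (c : nat -> R -> R -> R) (cT : R -> R)
    (V : nat -> R -> R) :
  state_space X -> transition_density X U p ->
  value_functions X U p T c cT V ->
  C1 X U T c cT -> C2 X U p -> C3 X U p ->
  forall t : nat, (1 <= t <= T)%N -> even_quasi_convex X (V t).
Proof.
move=> hX hp [hVT hV] [hcT hc] hC2 hC3 t /andP[t1 tT].
have [_ XN] := state_spaceP hX.
have [n nE] : exists n, (n + t)%N = T by exists (T - t)%N; rewrite subnK.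
elim: n t t1 tT nE => [|n IH] t t1 tT nE.
  have -> : t = T by [].
  have [cTE cTQ] := hcT; split=> [x Xx|x x' Xx Xx' x0 xx'].
    by rewrite !hVT//; [exact: cTE|exact: XN].
  by rewrite !hVT//; exact: cTQ.
have tT' : (1 <= t < T)%N by lia.
have hV1 : even_quasi_convex X (V t.+1) by apply: IH; lia.
(* A minimizer [v] at [x'] is tried at [x]: [V x <= Q x v <= Q x' v = V x']. Evenness uses this in
   both directions. *)
have Vle x x' v : X x -> X x' -> U v ->
    (Qfun X p c V t x v <= Qfun X p c V t x' v)%E ->
    Qfun X p c V t x' v = (V t x')%:E -> V t x <= V t x'.
  move=> Xx Xx' Uv le_Q QE; rewrite -lee_fin -QE.
  have [_ [w [_ wmin] ->]] := hV t x tT' Xx.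
  exact: le_trans (wmin v Uv) le_Q.
split=> [x Xx|x x' Xx Xx' x0 xx'].
  have XNx := XN _ Xx; apply/eqP; rewrite eq_le; apply/andP; split.
  - have [_ [v [Uv _] /esym QE]] := hV t x tT' Xx.
    apply: (Vle _ _ v) => //; rewrite (@Qfun_opp _ _ U)//.
    exact: (hc t v tT' Uv).1.
  - have [_ [v [Uv _] /esym QE]] := hV t (- x) tT' XNx.
    apply: (Vle _ _ v) => //; rewrite (@Qfun_opp _ _ U)//.
    exact: (hc t v tT' Uv).1.
have [_ [v [Uv _] /esym QE]] := hV t x' tT' Xx'.
apply: (Vle _ _ v) => //; apply: (@le_Qfun _ _ U) => //.
exact: (hc t v tT' Uv).2.
Qed.

(** * Monotone selection of minimizers *)

(** Topkis' exchange, with [Q] at the smaller state and [Q'] at the larger one. If [b' < b],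
    submodularity and optimality of [b] for [Q] give [Q' b <= Q' b']; so [b] minimizes [Q'] too,
    although [b'] is the largest minimizer. *)
Lemma argmin_homo (R : realType) (U : set R) (Q Q' : R -> \bar R) (b b' : R)
    (r r' : R) :
  (forall u v, U u -> U v -> (v <= u)%R -> Q' u + Q v <= Q' v + Q u)%E ->
  is_max (argmin U Q) b -> is_max (argmin U Q') b' ->
  (Q b = r%:E)%E -> (Q' b' = r'%:E)%E -> b <= b'.
Proof.
move=> sub [[Ub minb] maxb] [[Ub' minb'] maxb'] Qb Qb'.
rewrite leNgt; apply/negP => b'b.
suff : b <= b' by rewrite leNgt b'b.
apply: maxb'; split=> // u Uu; apply: le_trans (minb' u Uu); rewrite Qb'.
(* The right-hand side of the exchange inequality is finite, which excludes [+oo]; the two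
   minimality bounds exclude [-oo]. Real values then cancel. *)
have := minb b' Ub'; have := minb' b Ub.
have := sub b b' Ub Ub' (ltW b'b); rewrite Qb Qb'.
case: (Q' b) => [a'| |] //; case: (Q b') => [a| |] //.
by rewrite -!EFinD !lee_fin => *; lra.
Qed.

(** This supplies the finite optimal values needed for the cancellation in [argmin_homo]. *)
Lemma argmin_value (R : realType) (X U : set R) (p : R -> R -> R -> R)
    (T : nat) (c : nat -> R -> R -> R) (cT : R -> R) (V : nat -> R -> R)
    (t : nat) (x v : R) :
  value_functions X U p T c cT V -> (1 <= t < T)%N -> X x ->
  argmin U (Qfun X p c V t x) v -> Qfun X p c V t x v = (V t x)%:E.
Proof.
move=> [_ hV] tT Xx [Uv vmin]; have [_ [w [Uw wmin] ->]] := hV t x tT Xx.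
by apply/eqP; rewrite eq_le vmin// wmin.
Qed.

Unset Implicit Arguments.

(** The minimizers at [x] and [- x] coincide, but the prescribed rule takes the largest on one side
    and the smallest on the other. Quasi-convexity, which concerns [X_{>=0}], is therefore separated
    from evenness, asserted when minimizers at negative states are unique or when ties are always
    broken upwards. *)
Theorem theorem1 (R : realType) (X U : set R) (p : R -> R -> R -> R) (T : nat)
    (c : nat -> R -> R -> R) (cT : R -> R) (V : nat -> R -> R)
    (hX : state_space X) (hU : action_space U)
    (hp : transition_density X U p) (hc : regular_costs X U T c cT)
    (hV : value_functions X U p T c cT V) :
  (C1 X U T c cT -> C2 X U p -> C3 X U p ->
   forall t : nat, (1 <= t <= T)%N -> even_quasi_convex X (V t))
  /\
  (C1 X U T c cT -> C2 X U p -> C3 X U p -> C4 X U T c -> C5 X U p ->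
   (forall g : nat -> R -> R, optimal_strategy X U p T c V g ->
    forall t : nat, (1 <= t < T)%N ->
      quasi_convex_on X (g t) /\
      ((forall x : R, X x -> x < 0 ->
          is_subset1 (argmin U (Qfun X p c V t x))) ->
       even_quasi_convex X (g t)))
   /\
   (forall g : nat -> R -> R, greatest_optimal_strategy X U p T c V g ->
    forall t : nat, (1 <= t < T)%N -> even_quasi_convex X (g t))).
Proof.
split=> [hC1 hC2 hC3|hC1 hC2 hC3 hC4 hC5].
  exact: value_even_quasi_convex hV hC1 hC2 hC3.
have [_ XN] := state_spaceP hX.
have hV1 t : (1 <= t < T)%N -> even_quasi_convex X (V t.+1).
  move=> /andP[t1 tT].
  by apply: (value_even_quasi_convex hX hp hV hC1 hC2 hC3); rewrite tT.
have argminN t x : (1 <= t < T)%N -> X x ->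
    argmin U (Qfun X p c V t (- x)) = argmin U (Qfun X p c V t x).
  move=> tT Xx; have QN u : U u -> Qfun X p c V t (- x) u = Qfun X p c V t x u.
    move=> Uu; apply: (Qfun_opp hX hp hC2) => //; last exact: hV1.
    exact: (hC1.2 t u tT Uu).1.
  by apply/seteqP; split => v [Uv vmin]; split=> // u Uu; have := vmin u Uu;
    rewrite !QN.
(* Both selection rules take the largest minimizer on [X_{>=0}], so this serves both. *)
have quasi_convex_max (h : R -> R) t : (1 <= t < T)%N ->
    (forall x, X x -> 0 <= x -> is_max (argmin U (Qfun X p c V t x)) (h x)) ->
    quasi_convex_on X h.
  move=> tT hmax x x' Xx Xx' x0 xx'.
  have x'0 : 0 <= x' by exact: le_trans (ltW xx').
  have hx := hmax x Xx x0; have hx' := hmax x' Xx' x'0.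
  apply: (argmin_homo _ hx hx' (argmin_value hV tT Xx hx.1)
    (argmin_value hV tT Xx' hx'.1)) => u v Uu Uv vu.
  apply: (Qfun_submodular hX hp hC5) => //; [exact: hC4|exact: hV1|exact: ltW].
have is_max_uniq (A : set R) a b : is_max A a -> is_max A b -> a = b.
  by move=> [Aa ua] [Ab ub]; apply/eqP; rewrite eq_le ub// ua.
split=> g hg t tT.
- have qc : quasi_convex_on X (g t).
    apply: (quasi_convex_max _ _ tT) => x Xx x0.
    by have := hg t x tT Xx; rewrite x0.
  split=> // sub1; split=> // x Xx.
  have gmem y : X y -> argmin U (Qfun X p c V t y) (g t y).
    by move=> Xy; have := hg t y tT Xy; case: ifP => _ [].
  (* Uniqueness is assumed at negative states, so it is applied at whichever of [x] and [- x] is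
     negative. *)
  have [x0|x0|->] := ltgtP x 0; last by rewrite oppr0.
    apply: (sub1 x) => //; last exact: gmem.
    by rewrite -(argminN t x tT Xx); apply: gmem; exact: XN.
  apply: (sub1 (- x)); first exact: XN.
  - by rewrite oppr_lt0.
  - by apply: gmem; exact: XN.
  - by rewrite argminN//; exact: gmem.
- split; last by apply: (quasi_convex_max _ _ tT) => x Xx _; exact: hg.
  move=> x Xx; apply: is_max_uniq (hg t x tT Xx).
  by rewrite -(argminN t x tT Xx); apply: hg => //; exact: XN.
Qed.
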